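(* There is a norm-open absolutely convex set $U\subset \ell_1=c_0^*$ such that $\tilde{\tilde U}=\tilde U$ but $U$ is not boundedly regular.
   Context: Here $X=c_0$ and $X^*=\ell_1$, with scalars $\mathbb{R}$ or $\mathbb{C}$; weak* means the topology $w(\ell_1,c_0)$ and $\overline{\,\cdot\,}^{w^*}$ is the weak* closure. $B_{X^*}$ is the open unit ball of $X^*$. For a norm-open set $U\subset X^*$, a subset $B\subset U$ is $U$-bounded if it is bounded and has positive distance to $X^*\setminus U$ (void condition if $U=X^*$). A fundamental family of $U$-bounded sets is a sequence $(B_n)_{n\ge1}$ such that each $B_n$ is $U$-bounded, each $U$-bounded set is contained in some $B_n$, and there are $r_n>0$ with $B_n+r_nB_{X^*}\subset B_{n+1}$ for all $n$. The envelope of $U$ is the norm-open set $\tilde U:=\bigcup\{\overline{B}^{w^*}: B \text{ is } U\text{-bounded}\}$. $U$ is boundedly regular if, for a fundamental family $(U_n)$ of $U$-bounded sets, $(\overline{U_n}^{w^*})_n$ is a fundamental family of $\tilde U$-bounded sets (this does not depend on the choice of the family). *)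

(* Defs.v *)
From HB Require Import structures.
From mathcomp Require Import all_boot all_order all_algebra.
From mathcomp Require Import all_classical all_reals all_analysis.
From mathcomp Require Import complex.

Set Implicit Arguments.
Unset Strict Implicit.
Unset Printing Implicit Defensive.

Import Order.TTheory GRing.Theory Num.Theory.
Import numFieldNormedType.Exports.

Local Open Scope classical_set_scope.
Local Open Scope ring_scope.

(* The norm of a numFieldType K takes its values in K; for K = R[i] the
   modulus is the same function with values in R.  Convergence in K is that
   of the library, i.e., for the absolute value of K. *)
Record scalarField (R : realType) := ScalarField {
  scalar :> numFieldType;
  of_real : {rmorphism R -> scalar};
  modulus : scalar -> R;
  ler_of_real : {mono of_real : a b / a <= b};
  of_real_modulus : forall z, of_real (modulus z) = `|z| }.

Definition real_scalars (R : realType) : scalarField R :=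
  @ScalarField R R idfun (fun z => `|z|) (fun _ _ => erefl) (fun=> erefl).

Section complex_scalars.
Variable R : realType.

Let real_complex_norm (z : R[i]) : real_complex R (complex.Re `|z|) = `|z|.
Proof. by rewrite RRe_real// normr_real. Qed.

Definition complex_scalars : scalarField R :=
  @ScalarField R R[i] (real_complex R) (fun z => complex.Re `|z|)
    (@lecR R) real_complex_norm.

End complex_scalars.

Section modulus_theory.
Context {R : realType} {K : scalarField R}.
Implicit Types a b : K.

Lemma modulus_ge0 a : 0 <= modulus a.
Proof. by rewrite -(@ler_of_real _ K) of_real_modulus rmorph0. Qed.

Lemma ler_modulusD a b : modulus (a + b) <= modulus a + modulus b.
Proof. by rewrite -(@ler_of_real _ K) rmorphD/= !of_real_modulus ler_normD. Qed.

Lemma modulusM a b : modulus (a * b) = modulus a * modulus b.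
Proof.
by apply: (fmorph_inj (of_real K)); rewrite rmorphM/= !of_real_modulus normrM.
Qed.

Lemma modulusN a : modulus (- a) = modulus a.
Proof.
by apply: (fmorph_inj (of_real K)); rewrite !of_real_modulus normrN.
Qed.

Lemma modulusMn a n : modulus (a *+ n) = modulus a *+ n.
Proof.
apply: (fmorph_inj (of_real K)).
by rewrite rmorphMn/= !of_real_modulus normrMn.
Qed.

Lemma modulus0 : modulus (0 : K) = 0.
Proof.
by apply: (fmorph_inj (of_real K)); rewrite of_real_modulus rmorph0 normr0.
Qed.

Lemma modulus_eq0 a : modulus a = 0 -> a = 0.
Proof.
by move=> /(congr1 (of_real K)); rewrite of_real_modulus rmorph0 => /normr0P/eqP.
Qed.

End modulus_theory.

Section ell1.
Context {R : realType} (K : scalarField R).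

(* K^o makes sequences an lmodType K; K^o is convertible to K. *)
Definition summable_seq : {pred (nat -> K^o)} :=
  mem [set x : nat -> K^o | cvgn (series (fun n => modulus (x n : K)))].

Record ell1 := Ell1 {
  ell1_val :> nat -> K^o;
  ell1P : ell1_val \in summable_seq }.

HB.instance Definition _ := [isSub for ell1_val].
HB.instance Definition _ := [Choice of ell1 by <:].

Lemma summable_seq_submod_closed : submod_closed summable_seq.
Proof.
split=> [|a x y].
  rewrite inE/=; under eq_fun do rewrite modulus0.
  rewrite (_ : series _ = cst 0); first exact: is_cvg_cst.
  by apply/funext => n; rewrite /series/= big1.
rewrite !inE/= => cx cy.
apply: (@series_le_cvg _ _
  (fun n => modulus a * modulus (x n : K) + modulus (y n : K))) => [n|n|n|].
- exact: modulus_ge0.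
- by rewrite addr_ge0 ?mulr_ge0 ?modulus_ge0.
- by rewrite -modulusM; exact: ler_modulusD.
- have cax := is_cvg_seriesZ (k := modulus a) cx.
  exact: (is_cvg_seriesD cax cy).
Qed.

HB.instance Definition _ :=
  GRing.isSubmodClosed.Build _ _ summable_seq summable_seq_submod_closed.
HB.instance Definition _ := [SubChoice_isSubLmodule of ell1 by <:].

Definition ell1_norm (x : ell1) : R :=
  limn (series (fun n => modulus (x n : K))).

Let is_cvg_ell1 (x : ell1) : cvgn (series (fun n => modulus (x n : K))).
Proof. by have := ell1P x; rewrite inE. Qed.

Lemma ler_ell1_normD x y : ell1_norm (x + y) <= ell1_norm x + ell1_norm y.
Proof.
rewrite /ell1_norm -lim_seriesD; [|exact: is_cvg_ell1..].
apply: lim_series_le => [||n]; [exact: is_cvg_ell1| |exact: ler_modulusD].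
by apply: is_cvg_seriesD; exact: is_cvg_ell1.
Qed.

Lemma ell1_norm_eq0 x : ell1_norm x = 0 -> x = 0.
Proof.
move=> x0; apply/val_inj/funext => n; apply: (@modulus_eq0 _ K).
apply/eqP; rewrite eq_le modulus_ge0 andbT -x0.
have nd : nondecreasing_seq (series (fun n => modulus (x n : K))).
  by apply: nondecreasing_series => k _ _; exact: modulus_ge0.
apply: le_trans (nondecreasing_cvgn_le nd (@is_cvg_ell1 x) n.+1).
rewrite /series/= big_nat_recr//= lerDr.
by apply: sumr_ge0 => k _; exact: modulus_ge0.
Qed.

Lemma ell1_normMn x n : ell1_norm (x *+ n) = ell1_norm x *+ n.
Proof.
rewrite /ell1_norm -mulr_natl -[RHS](lim_seriesZ _ (@is_cvg_ell1 x)).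
congr (limn (series _)); apply/funext => k.
rewrite [RHS]mulr_natl -modulusMn; congr modulus.
by elim: n => [//|n ih]; rewrite !mulrS -ih.
Qed.

Lemma ell1_normN x : ell1_norm (- x) = ell1_norm x.
Proof.
by congr (limn (series _)); apply/funext => n; exact: modulusN.
Qed.

(* The norm is R-valued although the scalars are in K: ell1 is an lmodType K
   and a pseudoMetricNormedZmodType R. *)
HB.instance Definition _ := Num.Zmodule_isNormed.Build R ell1
  ler_ell1_normD ell1_norm_eq0 ell1_normMn ell1_normN.
HB.instance Definition _ := PseudoMetric.copy ell1 (pseudoMetric_normed ell1).
HB.instance Definition _ := isPointed.Build ell1 0.
HB.instance Definition _ := NormedZmod_PseudoMetric_eq.Build R ell1 erefl.

End ell1.

Section weak_star.
Context {R : realType} (K : scalarField R).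

Definition null_seq : {pred (nat -> K)} :=
  mem [set y : nat -> K | y @ \oo --> (0 : K)].

Record c0 := C0 {
  c0_val :> nat -> K;
  c0P : c0_val \in null_seq }.

HB.instance Definition _ := [isSub for c0_val].
HB.instance Definition _ := [Choice of c0 by <:].

Definition pairing (x : ell1 K) (y : c0) : K :=
  limn (series (fun n => (x n : K) * y n)).

(* w(ell1, c0): the coarsest topology that makes x |-> pairing x y continuous
   for all y in c0. *)
Definition weak_star : topologicalType :=
  initial_topology (pairing : ell1 K -> {ptws c0 -> K}).

Definition weak_star_closure (A : set (ell1 K)) : set (ell1 K) :=
  @closure weak_star A.

End weak_star.

Section bounded_regularity.
Context {R : realType} {K : scalarField R}.
Implicit Types (U B : set (ell1 K)) (F : nat -> set (ell1 K)).

Definition absolutely_convex U :=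
  forall (a b : K) x y, modulus a + modulus b <= 1 ->
    U x -> U y -> U (a *: x + b *: y).

(* The distance condition is void when U = setT. *)
Definition Ubounded U B :=
  [/\ B `<=` U, bounded_set B &
      exists2 d : R, 0 < d & forall x y, B x -> ~ U y -> d <= `|x - y|].

(* Families are indexed from 0 instead of 1. *)
Definition fundamental_family U F :=
  [/\ forall n, Ubounded U (F n),
      forall B, Ubounded U B -> exists n, B `<=` F n &
      forall n, exists2 r : R, 0 < r &
        forall x h, F n x -> `|h| < r -> F n.+1 (x + h)].

Definition envelope U : set (ell1 K) :=
  \bigcup_(B in Ubounded U) weak_star_closure B.

(* Every open U has a fundamental family, and the property does not depend on
   which one is chosen. *)
Definition boundedly_regular U :=
  exists2 F, fundamental_family U F &
    fundamental_family (envelope U) (fun n => weak_star_closure (F n)).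

End bounded_regularity.

(* Main.v *)
(** Partition [nat] into infinitely many infinite blocks and let [b(k,0)] be a
distinguished point of block [k].  The functionals
[f_k(x) = x_(b(k,0)) - (k+1)^-1 * (sum of x over block k)] have norm at most 1,
and [U] is the set where [sup_k |f_k(x)| < 1].  Adding
[(k+1) f_k(x)] times a unit vector far out in block [k] kills [f_k(x)] and is a
weak* small perturbation; only finitely many [k] need correction, since
[f_k(x)] is at most the norm of the tail of [x] from [k] on.  Hence every point
of [ell1] lies in the envelope.  The size of the correction grows with [k]:
a point of [U] of norm at most [M] has [|x_(b(k,0))| <= 1 + M / (k+1)], a
weak* closed condition, so the weak* closure of a [U]-bounded set never
contains the ball of radius 3, and [U] is not boundedly regular. *)

Require Import Defs.
From mathcomp Require Import all_boot all_order all_algebra.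
From mathcomp Require Import all_classical all_reals all_analysis.
From mathcomp Require Import lra.

Set Implicit Arguments.
Unset Strict Implicit.
Unset Printing Implicit Defensive.

Import Order.TTheory GRing.Theory Num.Theory.
Import numFieldNormedType.Exports.

Local Open Scope classical_set_scope.
Local Open Scope ring_scope.

(** * Moduli of scalars *)

Section scalars.
Context {R : realType} {K : scalarField R}.
Implicit Types a b : K.

Lemma modulus_of_real (r : R) : modulus (of_real K r) = `|r|.
Proof.
apply: (fmorph_inj (of_real K)); rewrite of_real_modulus.
case: (lerP 0 r) => [r0|/ltW r0].
  by rewrite (ger0_norm r0) ger0_norm// -(rmorph0 (of_real K)) ler_of_real.
rewrite (ler0_norm r0) ler0_norm ?rmorphN//.
by rewrite -(rmorph0 (of_real K)) ler_of_real.
Qed.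

Lemma modulus1 : modulus (1 : K) = 1.
Proof. by rewrite -(rmorph1 (of_real K)) modulus_of_real normr1. Qed.

Lemma ler_modulus_sum (I : Type) (r : seq I) (P : pred I) (F : I -> K) :
  modulus (\sum_(i <- r | P i) F i) <= \sum_(i <- r | P i) modulus (F i).
Proof.
elim/big_ind2 : _ => [|a s b t sa tb|//]; first by rewrite modulus0.
by rewrite (le_trans (ler_modulusD _ _))// lerD.
Qed.

Lemma ler_modulusB a b : modulus a - modulus b <= modulus (a - b).
Proof. by rewrite lerBlDr -{1}(subrK b a) ler_modulusD. Qed.

End scalars.

(** * Norm estimates and unit vectors in [ell1] *)

Section ell1_theory.
Context {R : realType} {K : scalarField R}.
Implicit Types (x y : ell1 K) (a : K).

Lemma ell1_is_cvg x : cvgn (series (fun n => modulus (x n : K))).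
Proof. by have := ell1P x; rewrite inE. Qed.

Lemma ell1_sum_le x m n : \sum_(m <= j < n) modulus (x j : K) <= `|x|.
Proof.
have nd : nondecreasing_seq (series (fun n => modulus (x n : K))).
  by apply: nondecreasing_series => k _ _; exact: modulus_ge0.
apply: le_trans (nondecreasing_cvgn_le nd (@ell1_is_cvg x) n).
rewrite /series/=; case: (leqP m n) => mn; last first.
  rewrite big_geq; last exact: ltnW.
  by apply: sumr_ge0 => k _; exact: modulus_ge0.
rewrite [leRHS](big_cat_nat _ mn)//= lerDr.
by apply: sumr_ge0 => k _; exact: modulus_ge0.
Qed.

Lemma ell1_tail_le x (e : R) : 0 < e ->
  exists N, forall n, \sum_(N <= j < n) modulus (x j : K) <= e.
Proof.
move=> e0; have := @ell1_is_cvg x.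
move/cvg_cauchy/cauchy_seriesP => /(_ e e0) [[A B] [[N _ NA] [M _ MB]] AB].
exists (maxn N M) => n; case: (leqP (maxn N M) n) => mn; last first.
  by rewrite big_geq; [exact: ltW|exact: ltnW].
have := AB (maxn N M, n) => /= /(_ _)/ltW.
rewrite ger0_norm ?sumr_ge0//; last by move=> *; exact: modulus_ge0.
apply; split; [exact: (NA _ (leq_maxl N M))|apply: MB => /=].
exact: leq_trans (leq_maxr N M) mn.
Qed.

Lemma ell1_normZ a x : `|a *: x| = modulus a * `|x|.
Proof.
rewrite -[RHS](lim_seriesZ _ (@ell1_is_cvg x)).
congr (limn (series _)); apply/funext => k.
exact: modulusM.
Qed.

Lemma summable_delta i :
  ((fun j => (j == i)%:R) : nat -> K^o) \in @summable_seq R K.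
Proof.
rewrite inE/=; apply/cvg_ex; exists 1; apply: cvg_near_cst.
exists i.+1 => // n /= lein; rewrite /series/=.
rewrite big_mkord (bigD1 (Ordinal lein))//= eqxx modulus1 big1 ?addr0// => j.
by rewrite -val_eqE/= => /negbTE ->; rewrite modulus0.
Qed.

Definition delta i : ell1 K := Ell1 (summable_delta i).

Lemma sum_delta (f : nat -> K) i n : (i < n)%N ->
  \sum_(0 <= j < n) (delta i j : K) * f j = f i.
Proof.
move=> lein; rewrite big_mkord (bigD1 (Ordinal lein))//= eqxx mul1r.
rewrite big1 ?addr0// => j.
by rewrite -val_eqE/= => /negbTE ->; rewrite mul0r.
Qed.

Lemma ell1_norm_delta i : `|delta i| = 1.
Proof.
apply: lim_near_cst; first exact: norm_hausdorff.
exists i.+1 => // n /= lein; rewrite /series/=.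
rewrite big_mkord (bigD1 (Ordinal lein))//= eqxx modulus1 big1 ?addr0// => j.
by rewrite -val_eqE/= => /negbTE ->; rewrite modulus0.
Qed.

Lemma ell1_boundedP (B : set (ell1 K)) :
  bounded_set B <-> exists M, forall x, B x -> `|x| <= M.
Proof.
split=> [/pinfty_ex_gt0[M _ BM]|[M BM]]; first by exists M.
exists M; split; first exact: num_real.
by move=> r Mr x /BM/le_trans; apply; exact: ltW.
Qed.

End ell1_theory.

(** * Weak* convergence and weak* closed conditions *)

Section weak_star_theory.
Context {R : realType} {K : scalarField R}.
Implicit Types (x d : ell1 K) (y : c0 K).

Lemma weak_star_cvg (z : nat -> ell1 K) x :
  (forall y, pairing (z n) y @[n --> \oo] --> pairing x y) ->
  z @ \oo --> (x : weak_star K).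
Proof.
move=> zx A /= [_ [[B Bop <-] Bx sBA]].
have cB : {ptws, (@pairing R K \o z) @ \oo --> @pairing R K x}.
  (* The product topology is the supremum of those induced by the evaluations; constant functions
     show that each evaluation is onto. *)
  apply/cvg_sup => y; apply/cvg_image.
    by rewrite eqEsubset; split=> v // _; exists (cst v).
  by move=> W /(zx y) zW; exists (@^~ y @^-1` W) => //; apply: image_preimage;
    rewrite eqEsubset; split=> v // _; exists (cst v).
have : nbhs (@pairing R K x : {ptws c0 K -> K}) B by exact: open_nbhs_nbhs.
move=> /cB zB; apply: (@filterS _ _ eventually_filter _ _ _ zB) => n.
exact: sBA.
Qed.

Lemma pairing_continuous y :
  continuous ((fun x => pairing x y) : weak_star K -> K).
Proof.
move=> x.
have c := @initial_continuous (ell1 K) {ptws c0 K -> K} (@pairing R K) x.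
exact: (continuous_comp c (@proj_continuous (c0 K) (fun=> K) y _)).
Qed.

(* [K] need not be complete, but when the series defining [pairing x y]
   diverges so does the one of [pairing (x + d) y], and both limits are the
   same junk value. *)
Lemma pairingD x d y :
  cvgn (series (fun n => (d n : K) * y n)) ->
  pairing (x + d) y = pairing x y + pairing d y \/
  pairing (x + d) y = pairing x y.
Proof.
move=> cd; have E : series (fun n => ((x + d) n : K) * y n) =
    series (fun n => (x n : K) * y n) \+ series (fun n => (d n : K) * y n).
  apply/funext => n; rewrite /series/= -big_split/=.
  by apply: eq_bigr => i _; rewrite -mulrDl.
case: (pselect (cvgn (series (fun n => (x n : K) * y n)))) => [cx|dx].
  by left; rewrite /pairing E (limD cx cd).
right; rewrite /pairing E (dvgP dx) dvgP// => cxd; apply: dx.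
have -> : series (fun n => (x n : K) * y n) =
   (series (fun n => (x n : K) * y n) \+ series (fun n => (d n : K) * y n))
    - series (fun n => (d n : K) * y n).
  by apply/funext => n; rewrite /= addrK.
exact: is_cvgB.
Qed.

Lemma cvg_pairing_delta i y :
  series (fun n => (delta i n : K) * y n) @ \oo --> y i.
Proof.
by apply: cvg_near_cst; exists i.+1 => // n /= lein; exact: sum_delta.
Qed.

(** Supplies the convergence that [pairingD] requires of the perturbation: each of the finitely many
    series is eventually constant. *)
Lemma cvg_pairing_sum_delta N (t : nat -> K) (i : nat -> nat) y :
  series (fun n =>
    ((\sum_(0 <= k < N) t k *: (delta (i k) : ell1 K)) n : K) * y n)
    @ \oo --> \sum_(0 <= k < N) t k * y (i k).
Proof.
have -> : series (fun n =>
    ((\sum_(0 <= k < N) t k *: (delta (i k) : ell1 K)) n : K) * y n) =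
  (fun n => \sum_(0 <= k < N)
     t k * series (fun n => (delta (i k) n : K) * y n) n).
  apply/funext => n; rewrite /series/=.
  under [RHS]eq_bigr do rewrite big_distrr/=.
  rewrite exchange_big/=; apply: eq_bigr => j _.
  elim/big_rec2 : _ => [|k a b _ ab]; first exact: mul0r.
  by rewrite mulrA -ab -mulrDl.
apply: cvg_big => [|k _]; first exact: add_continuous.
by apply: cvgM; [exact: cvg_cst|exact: cvg_pairing_delta].
Qed.

Lemma c0_cvg y : y @ \oo --> (0 : K).
Proof. by have := c0P y; rewrite inE. Qed.

Lemma null_seq_delta i : ((fun j => (j == i)%:R) : nat -> K) \in @null_seq R K.
Proof.
rewrite inE/=; apply: cvg_near_cst.
by exists i.+1 => // n /= /gtn_eqF ->.
Qed.

Lemma pairing_C0_delta x i : pairing x (C0 (null_seq_delta i)) = x i.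
Proof.
apply: cvg_lim; first exact: norm_hausdorff.
apply: cvg_near_cst; exists i.+1 => // n /= lein; rewrite /series/=.
under eq_bigr do rewrite mulrC.
exact: (@sum_delta _ K).
Qed.

(** The perturbation pairs with [y] to a sum of fixed length with terms [t k * y (i k n)], which
    tend to 0 because [y] is a null sequence. *)
Lemma weak_star_cvg_sum_delta x N (t : nat -> K) (i : nat -> nat -> nat) :
  (forall k, i k @ \oo --> \oo) ->
  (fun n => x + \sum_(0 <= k < N) t k *: (delta (i k n) : ell1 K)) @ \oo
    --> (x : weak_star K).
Proof.
move=> ioo; apply: weak_star_cvg => y.
pose d n := \sum_(0 <= k < N) t k *: (delta (i k n) : ell1 K).
have cd n := @cvg_pairing_sum_delta N t (i^~ n) y.
have d0 : pairing (d n) y @[n --> \oo] --> (0 : K).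
  have -> : (fun n => pairing (d n) y) =
      (fun n => \sum_(0 <= k < N) t k * y (i k n)).
    by apply/funext => n; apply: cvg_lim; [exact: norm_hausdorff|exact: cd].
  suff : \sum_(0 <= k < N) t k * y (i k n) @[n --> \oo] -->
      \sum_(0 <= k < N) t k * 0.
    by rewrite [X in _ --> X -> _]big1// => k _; rewrite mulr0.
  apply: cvg_big => [|k _]; first exact: add_continuous.
  have cy : y (i k n) @[n --> \oo] --> (0 : K).
    exact: (cvg_comp _ _ (ioo k) (@c0_cvg y)).
  exact: (cvgM (cvg_cst _) cy).
apply/cvgrPdist_le => e e0; move/cvgr0Pnorm_le : d0 => /(_ e e0).
apply: filterS => n dn.
(* In the two cases of [pairingD] the error is [pairing (d n) y] or 0. *)
have /cvgP cdn := cd n; case: (pairingD x cdn) => ->.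
  by rewrite opprD addNKr normrN.
by rewrite subrr normr0 ltW.
Qed.

(** A coordinate is the pairing with a unit vector of [c0], hence weak* continuous. *)
Lemma weak_star_closure_coord (A : set (ell1 K)) i (M : R) x :
  (forall z, A z -> modulus (z i : K) <= M) ->
  weak_star_closure A x -> modulus (x i : K) <= M.
Proof.
move=> AM Ax; apply/ler_addgt0Pr => e e0.
have e0' : 0 < of_real K e.
  by rewrite -(rmorph0 (of_real K)) (leW_mono (ler_of_real K)).
have := @pairing_continuous (C0 (null_seq_delta i)) x.
move=> /cvgrPdist_lt /(_ _ e0') /Ax[z [Az /=]].
rewrite !pairing_C0_delta -of_real_modulus (leW_mono (ler_of_real K)) => xz.
have := AM _ Az; have := ler_modulusB (x i : K) (z i : K); lra.
Qed.

End weak_star_theory.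

(** * The blocks, the functionals and the set [U] *)

Section counterexample.
Context {R : realType} {K : scalarField R}.
Implicit Types (x y h : ell1 K).

(** Each positive integer is uniquely a power of 2 times an odd number; the predecessor shifts this
    partition to [nat]. *)
Definition block_index k n : nat := (2 ^ k * n.*2.+1).-1.

Lemma block_indexS k n : (block_index k n).+1 = (2 ^ k * n.*2.+1)%N.
Proof. by rewrite prednK// muln_gt0 expn_gt0. Qed.

Lemma logn_block_index k n : logn 2 (block_index k n).+1 = k.
Proof.
rewrite block_indexS lognM ?expn_gt0// pfactorK// lognE/=.
by rewrite dvdn2/= odd_double/= addn0.
Qed.

Lemma block_index_inj k : injective (block_index k).
Proof.
move=> m n /(congr1 S); rewrite !block_indexS => /eqP.
by rewrite eqn_pmul2l ?expn_gt0// eqSS => /eqP/double_inj.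
Qed.

Lemma leq_block_index k n : (k <= block_index k n)%N.
Proof.
rewrite -ltnS block_indexS (leq_trans (ltn_expl k (ltnSn 1)))//.
exact: leq_pmulr.
Qed.

Lemma block_index_cvg k : block_index k @ \oo --> \oo.
Proof.
apply/cvgnyPge => M; exists M => // n /= Mn; rewrite (leq_trans Mn)//.
rewrite -ltnS block_indexS (leq_trans _ (leq_pmull _ _)) ?expn_gt0//.
by rewrite ltnS -addnn leq_addr.
Qed.

(* Block [k] is the range of [block_index k], i.e., the set of the [j] with
   [logn 2 j.+1 = k]. *)
Definition coef k j : K :=
  (j == block_index k 0)%:R - (logn 2 j.+1 == k)%:R * of_real K k.+1%:R^-1.

(* Partial sums of [f_k(x)] replace [f_k(x)] itself: [K] is not assumed to be
   complete, so the series might diverge. *)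
Definition psum k x n : K := \sum_(0 <= j < n) coef k j * (x j : K).

Lemma invS_ge0 k : 0 <= k.+1%:R^-1 :> R.
Proof. by rewrite invr_ge0. Qed.

Lemma invS_le1 k : k.+1%:R^-1 <= 1 :> R.
Proof. by rewrite invf_le1 ?ltr0Sn// ler1n. Qed.

(** The distinguished point has index 0, so at [n.+1] only the block-sum term is left; the
    correction vectors are placed there. *)
Lemma coef_block_index k i n :
  coef k (block_index i n.+1) = - ((i == k)%:R * of_real K k.+1%:R^-1).
Proof.
rewrite /coef logn_block_index; case: eqP => [eqb|_]; last by rewrite sub0r.
have ik : i = k by rewrite -(logn_block_index i n.+1) eqb logn_block_index.
by move: eqb; rewrite ik => /block_index_inj.
Qed.

Lemma modulus_coef_le1 k j : modulus (coef k j) <= 1.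
Proof.
rewrite /coef; case: (eqVneq j) => [->|_].
  rewrite logn_block_index eqxx mul1r -(rmorph1 (of_real K)) -rmorphB.
  rewrite modulus_of_real.
  by rewrite ger0_norm ?subr_ge0 ?invS_le1// gerBl invS_ge0.
rewrite sub0r modulusN; case: eqP => _; last by rewrite mul0r modulus0.
by rewrite mul1r modulus_of_real ger0_norm ?invS_ge0 ?invS_le1.
Qed.

Lemma coef_eq0 k j : (j < k)%N -> coef k j = 0.
Proof.
move=> jk; rewrite /coef.
have /ltn_eqF -> : (j < block_index k 0)%N.
  exact: leq_trans jk (leq_block_index _ _).
case: eqP => [jk'|_]; last by rewrite mul0r subr0.
(* On block [k] the number [2 ^ k] divides [j.+1], so the block starts no earlier than [k]. *)
have /(leq_trans (ltn_expl k (ltnSn 1))) : (2 ^ k <= j.+1)%N.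
  by rewrite dvdn_leq// -jk' pfactor_dvdnn.
by rewrite ltnS leqNgt jk.
Qed.

Lemma psumD k x y n : psum k (x + y) n = psum k x n + psum k y n.
Proof.
by rewrite /psum -big_split/=; apply: eq_bigr => j _; rewrite -mulrDr.
Qed.

Lemma psumZ k (a : K) x n : psum k (a *: x) n = a * psum k x n.
Proof.
by rewrite /psum big_distrr/=; apply: eq_bigr => j _; rewrite mulrCA.
Qed.

Lemma psum_sum k N (f : nat -> ell1 K) n :
  psum k (\sum_(0 <= i < N) f i) n = \sum_(0 <= i < N) psum k (f i) n.
Proof.
elim/big_ind2 : _ => [|x a y b <- <-|//]; last exact: psumD.
by rewrite /psum big1// => j _; exact: mulr0.
Qed.

Lemma psum_delta k i n : (i < n)%N -> psum k (delta i) n = coef k i.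
Proof.
move=> lein; rewrite -(sum_delta (coef k) lein).
by apply: eq_bigr => j _; rewrite mulrC.
Qed.

Lemma modulus_psumB_le k x m n : (m <= n)%N ->
  modulus (psum k x n - psum k x m) <= \sum_(m <= j < n) modulus (x j : K).
Proof.
move=> mn; rewrite {1}/psum (big_cat_nat (leq0n m) mn)/= -/(psum k x m).
rewrite [X in modulus X]addrC addKr.
apply: le_trans (ler_modulus_sum _ _ _) _; apply: ler_sum => j _.
by rewrite modulusM ler_piMl ?modulus_ge0 ?modulus_coef_le1.
Qed.

Lemma psum0 k x : psum k x 0 = 0.
Proof. by rewrite /psum big_geq. Qed.

Lemma modulus_psum_le k x n : modulus (psum k x n) <= `|x|.
Proof.
rewrite -[psum k x n]subr0 -(psum0 k x).
exact: le_trans (modulus_psumB_le _ _ _) (ell1_sum_le _ _ _).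
Qed.

Lemma psum_eq0 k x n : (n <= k)%N -> psum k x n = 0.
Proof.
move=> nk; rewrite /psum big_nat big1// => j /andP[_ jn].
by rewrite coef_eq0 ?mul0r// (leq_trans jn).
Qed.

(** One [r < 1] serves all [k], which keeps the supremum below 1; the threshold on [n] may depend on
    [k]. *)
Definition Uset : set (ell1 K) := [set x | exists2 r : R, r < 1 &
  forall k, \forall n \near \oo, modulus (psum k x n) <= r].

(** Each functional has norm at most 1. This gives both openness and positive distance to the
    complement. *)
Lemma Uset_add x h (r e : R) :
  (forall k, \forall n \near \oo, modulus (psum k x n) <= r) ->
  `|h| <= e -> r + e < 1 -> Uset (x + h).
Proof.
move=> xr he re; exists (r + e) => // k; apply: filterS (xr k) => n xn.
rewrite psumD (le_trans (ler_modulusD _ _))// lerD//.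
exact: le_trans (modulus_psum_le _ _ _) he.
Qed.

Lemma open_Uset : open Uset.
Proof.
rewrite openE => x [r r1 xr]; apply/nbhs_ballP.
have e0 : 0 < (1 - r) / 2 by rewrite divr_gt0 ?subr_gt0.
exists ((1 - r) / 2) => //= z; rewrite -ball_normE/= => xz.
rewrite -(subrK x z) addrC; apply: (Uset_add xr (e := (1 - r) / 2)).
  by rewrite distrC ltW.
lra.
Qed.

Lemma absolutely_convex_Uset : absolutely_convex Uset.
Proof.
move=> a b x y ab [r r1 xr] [s s1 ys].
exists (Num.max r s); first by rewrite gt_max r1.
move=> k; apply: filterS2 (xr k) (ys k) => n xn yn.
rewrite psumD !psumZ (le_trans (ler_modulusD _ _))// !modulusM.
have t0 : 0 <= Num.max r s.
  by rewrite le_max (le_trans (modulus_ge0 _) xn).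
apply: (@le_trans _ _ ((modulus a + modulus b) * Num.max r s)).
  by rewrite mulrDl lerD// ler_wpM2l ?modulus_ge0// le_max ?xn ?yn ?orbT.
by rewrite ler_piMl.
Qed.

Lemma envelope_Uset : envelope Uset = setT.
Proof.
rewrite -subTset => x _.
(* The tail bounds what remains of every functional after correction; [2^-1] leaves room below 1. *)
have [N tailN] := ell1_tail_le x (e := 2^-1) ltac:(by rewrite invr_gt0).
(* The factor [k.+1] offsets the coefficient [- k.+1%:R^-1] at the added unit vector, so that
   [psum k x N] is cancelled exactly. *)
pose t k := of_real K k.+1%:R * psum k x N.
pose z n := x + \sum_(0 <= k < N) t k *: (delta (block_index k n.+1) : ell1 K).
have zr n k : \forall m \near \oo, modulus (psum k (z n) m) <= 2^-1.
  near=> m.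
  have Nm : (N <= m)%N by near: m; exact: nbhs_infty_ge.
  (* Past all perturbed coordinates, the partial sums see every correction. *)
  have bm i : (i < N)%N -> (block_index i n.+1 < m)%N.
    move=> iN; apply: (@leq_trans (\max_(i < N) block_index i n.+1).+1).
      pose b (i : 'I_N) := block_index i n.+1.
      by rewrite ltnS (leq_bigmax (F := b) (Ordinal iN)).
    by near: m; exact: nbhs_infty_ge.
  have -> : psum k (z n) m = psum k x m - psum k x N.
    rewrite psumD psum_sum; congr (_ + _).
    transitivity (\sum_(0 <= i < N) if i == k then - psum k x N else 0).
      apply: eq_big_nat => i /andP[_ iN].
      rewrite psumZ psum_delta; last by apply: bm; rewrite iN.
      rewrite coef_block_index; case: eqP => [->|_]; last first.
        by rewrite mul0r oppr0 mulr0.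
      rewrite mul1r mulrN mulrAC -rmorphM divff ?pnatr_eq0//.
      by rewrite rmorph1 mul1r.
    (* For [k >= N] there is no correction, but then [psum k x N] is already 0. *)
    rewrite -big_mkcond/= big_nat1_eq/=; case: ltnP => // Nk.
    by rewrite psum_eq0 ?oppr0.
  exact: le_trans (modulus_psumB_le _ _ Nm) (tailN _).
have zx : z @ \oo --> (x : weak_star K).
  apply: (@weak_star_cvg_sum_delta _ _ x N t (fun k n => block_index k n.+1)).
  by move=> k; rewrite cvg_shiftS; exact: block_index_cvg.
exists (range z); last first.
  by move=> A /zx [n _ nA]; exists (z n); split; [exists n|apply: nA => /=].
split.
- move=> _ [n _ <-]; exists 2^-1; last exact: zr.
  by rewrite invf_lt1 ?ltr1n.
- apply/ell1_boundedP.
  exists (`|x| + \sum_(0 <= k < N) modulus (t k)) => _ [n _ <-].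
  rewrite (le_trans (ler_normD _ _))// lerD2l (le_trans (ler_norm_sum _ _ _))//.
  by apply: ler_sum => k _; rewrite ell1_normZ ell1_norm_delta mulr1.
- exists 4^-1; first by rewrite invr_gt0.
  move=> _ y [n _ <-] Uy; rewrite leNgt; apply/negP => zy; apply: Uy.
  rewrite -(subrK (z n) y) addrC.
  apply: (Uset_add (zr n) (e := 4^-1)); first by rewrite distrC ltW.
  lra.
Unshelve. all: by end_near. Qed.

Lemma envelope_setT : envelope (@setT (ell1 K)) = setT.
Proof.
rewrite -subTset => x _; exists [set x]; last exact: subset_closure.
split=> //; first by apply/ell1_boundedP; exists `|x| => _ ->.
by exists 1 => // y z _ [].
Qed.

(** The distinguished coordinate is the functional plus [k.+1%:R^-1] times the block sum, and the
    block sum is at most the norm. *)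
Lemma Uset_coord k x : Uset x ->
  modulus (x (block_index k 0) : K) <= 1 + `|x| / k.+1%:R.
Proof.
move=> [r r1 /(_ k) xr]; near \oo => n.
have xn : modulus (psum k x n) <= r by near: n.
have bn : (block_index k 0 < n)%N by near: n; exact: nbhs_infty_gt.
pose s := \sum_(0 <= j < n) (logn 2 j.+1 == k)%:R * (x j : K).
have -> : (x (block_index k 0) : K) = psum k x n + of_real K k.+1%:R^-1 * s.
  rewrite /psum.
  under eq_bigr do rewrite mulrBl.
  rewrite sumrB (@sum_delta _ K (fun j => x j))// big_distrr/=.
  under [X in _ - X]eq_bigr do rewrite mulrAC mulrC.
  by rewrite subrK.
apply: le_trans (ler_modulusD _ _) _.
apply: lerD; first exact: le_trans xn (ltW r1).
rewrite modulusM modulus_of_real ger0_norm ?invS_ge0// [leLHS]mulrC.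
rewrite ler_wpM2r ?invS_ge0// (le_trans _ (@ell1_sum_le _ _ x 0 n))//.
apply: le_trans (ler_modulus_sum _ _ _) _; apply: ler_sum => j _.
by case: eqP => _; rewrite ?mul1r// mul0r modulus0 modulus_ge0.
Unshelve. all: by end_near. Qed.

Lemma Uset_not_regular : ~ boundedly_regular Uset.
Proof.
move=> [F [UF _ _]]; rewrite envelope_Uset => -[_ clF _].
have [n Bn] : exists n,
    [set x : ell1 K | `|x| <= 3] `<=` weak_star_closure (F n).
  apply: clF; split=> //; first by apply/ell1_boundedP; exists 3.
  by exists 1 => // y z _ [].
have [FU /ell1_boundedP[M FM] _] := UF n.
(* With [M <= k.+1] the bound on the distinguished coordinate over [F n] is at most 2. *)
pose k := Num.bound `|M|.
have Mk : M <= k.+1%:R.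
  rewrite (le_trans (ler_norm M))// ltW//.
  by rewrite (lt_le_trans (archi_boundP (normr_ge0 M)))// ler_nat.
(* A point of norm 3 whose distinguished coordinate exceeds that bound. *)
pose x : ell1 K := of_real K 3 *: (delta (block_index k 0) : ell1 K).
have x3 : x (block_index k 0) = of_real K 3.
  by rewrite -[LHS]/(of_real K 3 * (_ == _)%:R) eqxx mulr1.
have : modulus (x (block_index k 0) : K) <= 2.
  apply: (weak_star_closure_coord _ (Bn x _)) => [z Fz|/=]; last first.
    by rewrite ell1_normZ ell1_norm_delta mulr1 modulus_of_real ger0_norm.
  rewrite (le_trans (Uset_coord k (FU _ Fz)))//.
  rewrite -[leRHS]/(1 + 1) lerD2l ler_pdivrMr// mul1r (le_trans _ Mk)//.
  exact: FM.
by rewrite x3 modulus_of_real ger0_norm// ler_nat.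
Qed.

Lemma exists_not_boundedly_regular : exists U : set (ell1 K),
  [/\ open U, absolutely_convex U,
      envelope (envelope U) = envelope U & ~ boundedly_regular U].
Proof.
exists Uset; split; [exact: open_Uset|exact: absolutely_convex_Uset| |].
- by rewrite envelope_Uset envelope_setT.
- exact: Uset_not_regular.
Qed.

End counterexample.

Theorem mainTheorem5 (R : realType) :
  (exists U : set (ell1 (real_scalars R)),
     [/\ open U, absolutely_convex U,
         envelope (envelope U) = envelope U & ~ boundedly_regular U]) /\
  (exists U : set (ell1 (complex_scalars R)),
     [/\ open U, absolutely_convex U,
         envelope (envelope U) = envelope U & ~ boundedly_regular U]).
Proof. by split; exact: exists_not_boundedly_regular. Qed.
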